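(* Let $G$ be a connected graph and let $H$ be a graph with $|V(H)|\geq 2$. Then the corona product $G\circ H$ is $2$-distance-balanced if and only if $G\cong K_1$ and $H$ is locally regular.
   Context: All graphs are simple, connected, undirected and finite. $K_1$ is the graph with one vertex. For a graph $X$, $d_X$ denotes the geodesic distance in $X$, and the diameter $\mathrm{diam}(X)$ is the maximum distance between pairs of vertices of $X$. For vertices $u,v$ of $X$, $W_{uv}=\{w\in V(X): d_X(w,u)<d_X(w,v)\}$. If $\ell$ is a positive integer and $\mathrm{diam}(X)\geq\ell$, then $X$ is called $\ell$-distance-balanced if $|W_{uv}|=|W_{vu}|$ for any pair of vertices $u,v\in V(X)$ with $d_X(u,v)=\ell$. A graph is locally regular if any non-adjacent vertices of it have the same degree. The corona product $G\circ H$ is the graph obtained by taking one copy of $G$ and $|V(G)|$ copies of $H$ and joining each vertex of the $i$-th copy of $H$ with the $i$-th vertex of $G$. *)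

(* Defs.v *)
From HB Require Import structures.
From mathcomp Require Import all_boot.

Set Implicit Arguments.
Unset Strict Implicit.
Unset Printing Implicit Defensive.

Record sgraph := SGraph {
  vertex :> finType;
  adj : rel vertex;
  adj_sym : symmetric adj;
  adj_irrefl : irreflexive adj }.

(* The empty graph is not connected: otherwise it would make the corona product
   empty, hence vacuously distance-balanced. *)
Definition connected_graph (X : sgraph) : Prop :=
  0 < #|X| /\ forall x y : X, connect (@adj X) x y.

Definition degree (X : sgraph) (x : X) : nat := #|[set y | adj x y]|.

Definition isomorphic (X Y : sgraph) : Prop :=
  exists f : X -> Y, bijective f /\ forall x y, adj (f x) (f y) = adj x y.

Section CompleteGraph.
Variable n : nat.
Definition complete_adj : rel 'I_n := fun i j => i != j.
Lemma complete_adj_sym : symmetric complete_adj.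
Proof. by move=> i j; rewrite /complete_adj eq_sym. Qed.
Lemma complete_adj_irrefl : irreflexive complete_adj.
Proof. by move=> i; rewrite /complete_adj eqxx. Qed.
Definition complete_graph : sgraph :=
  SGraph complete_adj_sym complete_adj_irrefl.
End CompleteGraph.

Definition walk_of_length (X : sgraph) (n : nat) (x y : X) : bool :=
  [exists p : n.-tuple X, path (@adj X) x p && (last x p == y)].

(* The least length of a walk from x to y. A shortest walk has fewer than #|X|
   edges, so the search below finds it; the value is #|X| when x and y lie in
   different components. *)
Definition dist (X : sgraph) (x y : X) : nat :=
  find (fun n => walk_of_length n x y) (iota 0 #|X|).

Definition diam (X : sgraph) : nat := \max_(x : X) \max_(y : X) dist x y.

(* W_{uv} *)
Definition closer (X : sgraph) (u v : X) : {set X} :=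
  [set w | dist w u < dist w v].

(* The notion is meant for l <= diam X; otherwise no pair is at distance l and
   the condition is vacuous. Requiring l <= diam X as a conjunct would instead
   make the complete graph on n.+1 vertices, which is the corona product of K_1
   and the locally regular K_n, fail to be 2-distance-balanced. *)
Definition distance_balanced (l : nat) (X : sgraph) : Prop :=
  l <= diam X ->
  forall u v : X, dist u v = l -> #|closer u v| = #|closer v u|.

(* Complete graphs qualify vacuously. *)
Definition locally_regular (X : sgraph) : Prop :=
  forall x y : X, ~~ adj x y -> degree x = degree y.

Section Corona.
Variables G H : sgraph.

(* inl g is the vertex g of G; inr (g, h) is the vertex h of the g-th copy
   of H. *)
Definition corona_adj : rel (G + G * H) := fun a b =>
  match a, b with
  | inl g, inl g' => adj g g'
  | inl g, inr (g', _) => g == g'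
  | inr (g, _), inl g' => g == g'
  | inr (g, h), inr (g', h') => (g == g') && adj h h'
  end.

Lemma corona_adj_sym : symmetric corona_adj.
Proof.
move=> [g|[g h]] [g'|[g' h']] //=; first exact: adj_sym.
by rewrite eq_sym adj_sym.
Qed.

Lemma corona_adj_irrefl : irreflexive corona_adj.
Proof. by move=> [g|[g h]] /=; rewrite adj_irrefl ?andbF. Qed.

Definition corona : sgraph := SGraph corona_adj_sym corona_adj_irrefl.
End Corona.

(* Main.v *)
Require Import Defs.
From HB Require Import structures.
From mathcomp Require Import all_boot.

Set Implicit Arguments.
Unset Strict Implicit.
Unset Printing Implicit Defensive.

(** Suppose first that [G] has an edge [g g'], and compare a vertex [u = (g, h)]
of the copy of [H] at [g] with the vertex [v = g'], at distance 2 from [u].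
A walk can only enter the copy at [g] through [g], which is as close to [v] as
it is to [u]; hence every vertex closer to [u] lies in that copy, and there are
at most [#|H|] of them ([card_closer_copy]). On the other hand [g'] and the
whole copy of [H] at [g'] are closer to [v], which makes at least [#|H| + 1]
vertices ([card_closer_root]). So 2-distance-balance leaves [G] without edges,
and being connected [G] is a single vertex.

When [G] is a single vertex the corona is a cone over [H], and all its distances
are at most 2. In such a graph, if [u] and [v] are at distance 2, the vertices
closer to [u] are [u] itself and the neighbours of [u] that are not neighbours
of [v]; since the common neighbours are counted in both degrees, balance at
[u, v] says that [u] and [v] have the same degree ([distance_balanced2P]).
Finally the apex of the cone is adjacent to every other vertex and raises each
degree of [H] by one, so the cone is locally regular exactly when [H] is. *)

(** * Distances and balance in diameter 2 *)

Section Distance.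
Variable X : sgraph.
Implicit Types x y z u v : X.

Lemma walkP n x y :
  reflect (exists p, [/\ path (@adj X) x p, last x p = y & size p = n])
          (walk_of_length n x y).
Proof.
apply: (iffP existsP) => [[p /andP[xp /eqP lp]] | [p [xp lp <-]]].
  by exists p; rewrite xp lp size_tuple.
by exists (in_tuple p); rewrite xp lp eqxx.
Qed.

Lemma dist_le_size x (p : seq X) :
  path (@adj X) x p -> dist x (last x p) <= size p.
Proof.
move=> xp; case: (ltnP (size p) #|X|) => [ltp | lep]; last first.
  by apply: leq_trans lep; rewrite -[leqRHS](size_iota 0) find_size.
rewrite leqNgt; apply/negP => /(before_find 0).
by rewrite nth_iota // add0n => /walkP[]; exists p.
Qed.

(** Shortening a walk to a path bounds its length by the number of vertices, so
the bounded search in the definition of [dist] does succeed. *)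
Lemma dist_path x y : connect (@adj X) x y ->
  exists p, [/\ path (@adj X) x p, last x p = y & size p = dist x y].
Proof.
move=> /connectP[p0 /shortenP[p xp Up _] ->{p0}].
have ltp: size p < #|X|.
  by have := max_card [in x :: p]; rewrite (card_uniqP Up).
have hasp: has (fun n => walk_of_length n x (last x p)) (iota 0 #|X|).
  by apply/hasP; exists (size p); [rewrite mem_iota | apply/walkP; exists p].
apply/walkP; have := nth_find 0 hasp.
by move: hasp; rewrite has_find size_iota => hasp; rewrite nth_iota.
Qed.

Lemma dist_id x : dist x x = 0.
Proof. by apply/eqP; rewrite -leqn0; exact: (@dist_le_size x [::]). Qed.

Lemma dist_adj_le1 x y : adj x y -> dist x y <= 1.
Proof. by move=> xy; apply: (@dist_le_size x [:: y]); rewrite /= xy. Qed.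

Lemma dist_le2 x z y : adj x z -> adj z y -> dist x y <= 2.
Proof. by move=> xz zy; apply: (@dist_le_size x [:: z; y]); rewrite /= xz zy. Qed.

Lemma dist_le_diam x y : dist x y <= diam X.
Proof.
apply: leq_trans (leq_bigmax x).
exact: (leq_bigmax (F := fun y => dist x y)).
Qed.

Hypothesis connX : forall x y, connect (@adj X) x y.

Lemma dist_triangle z x y : dist x y <= dist x z + dist z y.
Proof.
have [p [xp lp <-]] := dist_path (connX x z).
have [q [zq lq <-]] := dist_path (connX z y).
rewrite -size_cat -lq -[in last z q]lp -last_cat.
by apply: dist_le_size; rewrite cat_path xp lp.
Qed.

Lemma dist_le1E x y : (dist x y <= 1) = (x == y) || adj x y.
Proof.
apply/idP/orP => [|[/eqP->|]]; [|by rewrite dist_id|exact: dist_adj_le1].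
have [p [xp <- <-]] := dist_path (connX x y).
case: p xp => [|z [|]] //=; first by left.
by rewrite andbT => xz _; right.
Qed.

Lemma dist_ltE0 x y : (dist x y < 1) = (x == y).
Proof.
apply/idP/eqP => [|->]; last by rewrite dist_id.
by have [[|? ?] [_ /= <- <-]] := dist_path (connX x y).
Qed.

(** In diameter at most 2, membership in [closer u v] is decided by adjacency to
[u] and [v] alone. *)
Lemma card_closer_diam2 u v : (forall x y, dist x y <= 2) ->
    ~~ adj u v -> u != v ->
  #|closer u v| + #|[set w | adj u w] :&: [set w | adj v w]| = (degree u).+1.
Proof.
move=> le2 nuv neq_uv.
have ->: closer u v = u |: ([set w | adj u w] :\: [set w | adj v w]).
  apply/setP=> w; rewrite !inE (adj_sym v) (adj_sym u).
  have [-> | neq_wu] := eqVneq w u.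
    by rewrite dist_id lt0n -leqn0 -ltnS dist_ltE0 (negPf neq_uv).
  have := le2 w v; have := dist_le1E w u; have := dist_le1E w v.
  have := dist_ltE0 w u; rewrite (negPf neq_wu) /=.
  have [-> | _] := eqVneq w v.
    by rewrite dist_id ltn0 adj_sym (negPf nuv) andbF.
  case: (dist w u) => [|[|du]] // _; case: (dist w v) => [|[|[|dv]]] //=;
    by move=> <- <-.
by rewrite cardsU1 !inE adj_irrefl andbF addSn addnC cardsID.
Qed.

Lemma dist_eq2 u v : dist u v <= 2 -> ~~ adj u v -> u != v -> dist u v = 2.
Proof.
move=> le2 nuv neq_uv; apply/eqP.
by rewrite eqn_leq le2 ltnNge dist_le1E negb_or neq_uv.
Qed.

(** The common neighbours of [u] and [v] contribute the same amount to both
instances of [card_closer_diam2], and cancel. *)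
Lemma closer2_eq_degree u v : (forall x y, dist x y <= 2) ->
    ~~ adj u v -> u != v ->
  (#|closer u v| == #|closer v u|) = (degree u == degree v).
Proof.
move=> le2 nuv neq_uv; rewrite -[RHS]eqSS.
rewrite -(card_closer_diam2 le2 nuv neq_uv).
rewrite -(@card_closer_diam2 v u) // 1?adj_sym 1?eq_sym //.
by rewrite [_ :&: [set w | adj u w]]setIC eqn_add2r.
Qed.

Lemma distance_balanced2P : (forall x y, dist x y <= 2) ->
  distance_balanced 2 X <-> locally_regular X.
Proof.
move=> le2; split=> [dbX u v nuv | regX _ u v duv].
  have [-> // | neq_uv] := eqVneq u v.
  have duv := dist_eq2 (le2 u v) nuv neq_uv.
  apply/eqP; rewrite -closer2_eq_degree //; apply/eqP.
  by apply: dbX => //; rewrite -duv dist_le_diam.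
have := dist_le1E u v; rewrite duv => /esym/norP[neq_uv nuv].
by apply/eqP; rewrite closer2_eq_degree //; apply/eqP/regX.
Qed.

End Distance.

(** * One-vertex graphs *)

Lemma isomorphic_K1P (G : sgraph) :
  isomorphic G (complete_graph 1) <-> #|G| = 1.
Proof.
split=> [[f [/bij_eq_card-> _]] | G1]; first exact: card_ord.
have /fintype1P[g allg] : #|G| == 1 by apply/eqP.
exists (fun=> ord0 : complete_graph 1); split=> [|x y].
  by exists (fun=> g) => [x | i]; [rewrite (allg x) | rewrite ord1].
by rewrite (allg x) (allg y) !adj_irrefl.
Qed.

(** In a connected graph a walk between two distinct vertices has a first
edge. *)
Lemma connected_no_edge (G : sgraph) :
  connected_graph G -> (forall x y : G, ~~ adj x y) -> #|G| = 1.
Proof.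
move=> [G_gt0 connG] noedge; apply/eqP; rewrite eqn_leq G_gt0 andbT.
apply/fintype_le1P => x y; have /connectP[[|z p] //= + ->] := connG x y.
by rewrite (negPf (noedge x z)).
Qed.

(** * Corona products *)

Section CoronaProduct.
Variables G H : sgraph.
Local Notation GH := (corona G H).
Local Notation root g := (inl g : GH).
Local Notation leaf g h := (inr (g, h) : GH).
Local Notation copy g := [set leaf g h | h : H].

Lemma mem_copyr g g' h : (leaf g' h \in copy g) = (g' == g).
Proof.
apply/imsetP/eqP => [[k _ [-> _]] // | ->]; by exists h.
Qed.

Lemma mem_copyl g g' : (root g' \in copy g) = false.
Proof. by apply/negP => /imsetP[]. Qed.

Lemma card_copy g : #|copy g| = #|H|.
Proof. by rewrite card_imset // => h k []. Qed.

Lemma degree_leaf g h : degree (leaf g h) = (degree h).+1.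
Proof.
have ->: (degree h).+1 = #|root g |: [set leaf g k | k in [set k | adj h k]]|.
  rewrite cardsU1 card_imset => [|k k' [] //].
  by rewrite (negPf (_ : root g \notin _)) //; apply/negP => /imsetP[].
apply: eq_card => -[g' | [g' k]]; rewrite !inE /=.
  rewrite -[inl g' == _]/(g' == g) eq_sym.
  by case: eqP => //= _; apply/esym/negP => /imsetP[].
apply/andP/imsetP => [[/eqP<- hk] | [k']]; first by exists k; rewrite ?inE.
by rewrite inE => hk' [-> ->].
Qed.

Hypothesis connG : forall x y : G, connect (@adj G) x y.

Lemma corona_connected (a b : GH) : connect (@adj GH) a b.
Proof.
have conn_root g g' : connect (@adj GH) (root g) (root g').
  have /connectP[p gp ->] := connG g g'; elim: p g gp => //= x p IHp g.
  by case/andP=> gx /IHp; apply: connect_trans; apply: connect1.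
have to_root (c : GH) : exists g, connect (@adj GH) c (root g).
  by case: c => [g | [g h]]; exists g => //; apply: connect1 => /=.
have [g ag] := to_root a; have [g' bg'] := to_root b.
apply: connect_trans ag (connect_trans (conn_root g g') _).
by rewrite (sym_connect_sym (@adj_sym GH)).
Qed.

(** The root of a copy is the only vertex outside it with neighbours inside, so
a walk into the copy passes through the root before its last step. *)
Lemma dist_root_lt g (a b : GH) :
  a \notin copy g -> b \in copy g -> dist a (root g) < dist a b.
Proof.
move=> + bg; have [p [ap lp <-]] := dist_path (corona_connected a b).
elim: p a ap lp => [a _ /= -> | c p IHp a /= /andP[ac cp] lp] ag.
  by rewrite bg in ag.
have [cg | cg] := boolP (c \in copy g); last first.
  apply: leq_ltn_trans (dist_triangle corona_connected c _ _) _.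
  rewrite ltnS; apply: leq_trans (IHp c cp lp cg).
  by rewrite -add1n leq_add2r; apply: dist_adj_le1.
case/imsetP: cg ac => h _ ->; case: a ag => [g' _ /eqP-> | [g' k]].
  by rewrite dist_id.
by rewrite mem_copyr => /negPf /= ->.
Qed.

(** Outside the copy at [g], going to [g'] through [g] is no longer than going
to the leaf. *)
Lemma card_closer_copy g g' h : adj g g' ->
  #|closer (leaf g h) (root g')| <= #|H|.
Proof.
move=> gg'; rewrite -(card_copy g); apply/subset_leq_card/subsetP => a.
rewrite inE => lt_a; apply: contraLR lt_a => ag; rewrite -leqNgt.
apply: leq_trans (dist_triangle corona_connected (root g) _ _) _.
apply: leq_trans (dist_root_lt ag (_ : leaf g h \in _)).
  by rewrite -[in leqRHS]addn1 leq_add2l; apply: dist_adj_le1.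
by rewrite mem_copyr.
Qed.

(** The copy at [g'], together with its root, is within distance 1 of [g'], and
none of its vertices is equal or adjacent to a leaf over [g]. *)
Lemma card_closer_root g g' h : adj g g' ->
  #|H| < #|closer (root g') (leaf g h)|.
Proof.
move=> gg'; have neq: g' != g by apply: contraTneq gg' => ->; rewrite adj_irrefl.
have ->: #|H|.+1 = #|root g' |: copy g'|.
  by rewrite cardsU1 mem_copyl card_copy.
apply/subset_leq_card/subsetP => a; rewrite !inE => a_near.
apply: (@leq_ltn_trans 1).
  rewrite dist_le1E; last exact: corona_connected.
  by case/predU1P: a_near => [->|/imsetP[k _ ->]] /=; rewrite eqxx ?orbT.
rewrite ltnNge dist_le1E; last exact: corona_connected.
case/predU1P: a_near => [->|/imsetP[k _ ->]]; first exact: neq.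
by rewrite -[inr _ == _]/((g', k) == (g, h)) xpair_eqE /= (negPf neq).
Qed.

Lemma balanced_no_edge : 0 < #|H| -> distance_balanced 2 GH ->
  forall g g' : G, ~~ adj g g'.
Proof.
move=> /card_gt0P[h _] dbGH g g'; apply/negP => gg'.
have neq: g != g' by apply: contraTneq gg' => ->; rewrite adj_irrefl.
have d2: dist (leaf g h) (root g') = 2.
  apply: (dist_eq2 corona_connected) => //.
  by apply: (@dist_le2 GH _ (root g)) => //=.
have diam2: 2 <= diam GH by rewrite -d2 dist_le_diam.
have := card_closer_root h gg'.
by rewrite -(dbGH diam2 _ _ d2) ltnNge card_closer_copy.
Qed.

End CoronaProduct.

(** * Cones *)

Section Cone.
Variables G H : sgraph.
Hypothesis G1 : #|G| = 1.

Lemma cone_eq (x y : G) : x = y.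
Proof. by apply: fintype_le1P; rewrite G1. Qed.

Lemma cone_dist_le2 (a b : corona G H) : dist a b <= 2.
Proof.
case: a b => [g | [g h]] [g' | [g' h']]; rewrite (cone_eq g' g).
- by rewrite dist_id.
- by apply: ltnW; apply: dist_adj_le1 => /=.
- by apply: ltnW; apply: dist_adj_le1 => /=.
- by apply: (@dist_le2 (corona G H) _ (inl g)) => /=.
Qed.

Lemma cone_locally_regular : locally_regular (corona G H) <-> locally_regular H.
Proof.
split=> [reg h h' nhh' | reg [g | [g h]] [g' | [g' h']]]; last 1 first.
- by rewrite (cone_eq g' g) /= eqxx !degree_leaf => /reg->.
- have /card_gt0P[g _]: 0 < #|G| by rewrite G1.
  apply: succn_inj; rewrite -!(degree_leaf g); apply: reg.
  by rewrite /= eqxx.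
- by rewrite (cone_eq g' g).
- by rewrite (cone_eq g' g) /= eqxx.
- by rewrite (cone_eq g' g) /= eqxx.
Qed.

End Cone.

Theorem proposition4p1 (G H : sgraph) (hG : connected_graph G)
    (hH : 2 <= #|H|) :
  distance_balanced 2 (corona G H) <->
  isomorphic G (complete_graph 1) /\ locally_regular H.
Proof.
have [_ connG] := hG; have connGH := @corona_connected G H connG.
have coneP (G1 : #|G| = 1) :
    distance_balanced 2 (corona G H) <-> locally_regular H.
  apply: iff_trans (cone_locally_regular H G1).
  exact: distance_balanced2P connGH (cone_dist_le2 G1).
split=> [dbGH | [/isomorphic_K1P/coneP[_]]]; last exact.
have G1: #|G| = 1.
  exact/(connected_no_edge hG)/(balanced_no_edge connG (ltnW hH) dbGH).
by split; [apply/isomorphic_K1P | apply/(coneP G1)].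
Qed.
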